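(* Let $\langle w_n\rangle_{n=1}^{\infty}$ and $\langle u_n\rangle_{n=1}^{\infty}$ be two sequences of real numbers such that for every $n\in\mathbb{N}$ and every choice of $k\in\mathbb{N}$ and $n_1,\dots,n_k\in\mathbb{N}$ with $n_1+\cdots+n_k=n$ one has $$w_n\le u_{n_1}+\cdots+u_{n_k}.$$ Then there exists a subadditive sequence $\langle v_n\rangle_{n=1}^{\infty}$ such that $w_n\le v_n\le u_n$ for all $n\in\mathbb{N}$.
   Context: $\mathbb{N}=\{1,2,3,\dots\}$. A real sequence $\langle v_n\rangle_{n=1}^{\infty}$ is subadditive if $v_{m+n}\le v_m+v_n$ for all $m,n\in\mathbb{N}$. *)

(* Defs.v *)
From mathcomp Require Import all_boot all_order all_algebra.
From mathcomp Require Import reals.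

Set Implicit Arguments.
Unset Strict Implicit.
Unset Printing Implicit Defensive.

Import Order.TTheory GRing.Theory Num.Theory.
Local Open Scope ring_scope.

(* A sequence indexed by {1, 2, 3, ...} is a function on nat whose value at 0
   is irrelevant: every condition is restricted to positive indices. *)
Definition subadditive_seq (R : realType) (v : nat -> R) : Prop :=
  forall m n : nat, (0 < m)%N -> (0 < n)%N -> v (m + n)%N <= v m + v n.

(* Main.v *)
(* The witness is the subadditive envelope of u: v n is the infimum of
   u n_1 + ... + u n_k over all compositions n_1 + ... + n_k = n. Concatenating
   compositions of m and n gives one of m + n, whence subadditivity; the
   hypothesis says that w n is a lower bound, and the one-part composition gives
   v n <= u n. *)
Require Import Defs.
From mathcomp Require Import all_boot all_order all_algebra.
From mathcomp Require Import classical_sets reals.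

Set Implicit Arguments.
Unset Strict Implicit.
Unset Printing Implicit Defensive.

Import Order.TTheory GRing.Theory Num.Theory.
Local Open Scope ring_scope.

(** Lists make joining two compositions a plain [++]; the empty list occurs only for [n = 0]. *)
Definition composition_sums (R : realType) (u : nat -> R) (n : nat) : set R :=
  [set x | exists s : seq nat,
    [/\ all (ltn 0) s, sumn s = n & x = \sum_(i <- s) u i]]%classic.

Definition subadditive_envelope (R : realType) (u : nat -> R) (n : nat) : R :=
  inf (composition_sums u n).

Lemma composition_sums1 (R : realType) (u : nat -> R) n :
  (0 < n)%N -> composition_sums u n (u n).
Proof.
by move=> n0; exists [:: n]; rewrite /= n0 addn0 big_seq1.
Qed.

Lemma composition_sumsD (R : realType) (u : nat -> R) m n x y :
  composition_sums u m x -> composition_sums u n y ->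
  composition_sums u (m + n) (x + y).
Proof.
move=> [s [s0 <- ->]] [t [t0 <- ->]]; exists (s ++ t).
by rewrite all_cat s0 t0 sumn_cat big_cat.
Qed.

(** The lower bounds keep [inf] from taking its default value 0. *)
Lemma subadditive_envelope_subadditive (R : realType) (u : nat -> R) :
  (forall n, (0 < n)%N -> has_lbound (composition_sums u n)) ->
  subadditive_seq (subadditive_envelope u).
Proof.
(* Isolating each infimum in turn on the right reduces the goal to a bound by [x + y] for arbitrary
   sums [x] and [y]. *)
move=> ulb m n m0 n0; rewrite -lerBlDr.
apply: lb_le_inf; first by exists (u m); exact: composition_sums1.
move=> x ux; rewrite lerBlDr addrC -lerBlDr.
apply: lb_le_inf; first by exists (u n); exact: composition_sums1.
move=> y uy; rewrite lerBlDr addrC.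
apply: ge_inf; last exact: composition_sumsD.
by apply: ulb; rewrite addn_gt0 m0.
Qed.

Theorem corollary1p4 (R : realType) (w u : nat -> R)
    (hwu : forall n : nat, (0 < n)%N ->
       forall k : nat, (0 < k)%N ->
       forall a : 'I_k -> nat, (forall i : 'I_k, (0 < a i)%N) ->
       (\sum_(i < k) a i)%N = n ->
       w n <= \sum_(i < k) u (a i)) :
  exists v : nat -> R,
    subadditive_seq v /\
    (forall n : nat, (0 < n)%N -> w n <= v n /\ v n <= u n).
Proof.
have wlb n : (0 < n)%N -> lbound (composition_sums u n) (w n).
  (* Indexing [s] by ['I_(size s)] through [nth] gives a family to which [hwu] applies. *)
  move=> n0 _ [s [/(all_nthP 0%N) s0 sn ->]]; rewrite (big_nth 0%N) big_mkord.
  (* An empty [s] would have sum 0, against [0 < n]. *)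
  apply: hwu => //; first by case: s sn {s0} n0 => // <-.
    by move=> i; exact: s0.
  by rewrite -sn sumnE (big_nth 0%N) big_mkord.
have ulb n : (0 < n)%N -> has_lbound (composition_sums u n).
  by move=> n0; exists (w n); exact: wlb.
exists (subadditive_envelope u); split.
  exact: subadditive_envelope_subadditive.
move=> n n0; split; last by apply: ge_inf; [exact: ulb | exact: composition_sums1].
by apply: lb_le_inf; [exists (u n); exact: composition_sums1 | exact: wlb].
Qed.
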